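(* For any SCC $F:\Theta\to 2^Z\setminus\{\emptyset\}$ the following are equivalent: (i) $F$ is pure-Nash-implementable; (ii) $F$ is mixed-Nash-A-implementable; (iii) $F$ is mixed-Nash-B-implementable.
   Context: Standing setup: $\mathcal I=\{1,\dots,I\}$ finite, $I\ge 3$; $\Theta$ finite or countably infinite; $Z$ finite; $Y=\Delta(Z)$; $u_i^\theta:Z\to\mathbb R$, $U_i^\theta(y)=\sum_z y_zu_i^\theta(z)$. A mechanism $\mathcal M=\langle M=\times_iM_i,g:M\to Y\rangle$ has countable $M_i$; $g(\lambda)$ is the lottery induced by a profile $\lambda$; $PNE^{(\mathcal M,\theta)}$, $MNE^{(\mathcal M,\theta)}$ are the sets of pure and mixed Nash equilibria at $\theta$. $F$ is pure-Nash-implementable if some $\mathcal M$ satisfies $\bigcup_{\lambda\in PNE^{(\mathcal M,\theta)}}\mathrm{SUPP}(g[\lambda])=F(\theta)$ for all $\theta$; mixed-Nash-A-implementable if some $\mathcal M$ satisfies $\bigcup_{\lambda\in MNE^{(\mathcal M,\theta)}}\mathrm{SUPP}(g[\lambda])=F(\theta)$ for all $\theta$; mixed-Nash-B-implementable if some $\mathcal M$ satisfies $\bigcup_{\lambda\in MNE^{(\mathcal M,\theta)}}\mathrm{SUPP}(g[\lambda])=\bigcup_{\lambda\in PNE^{(\mathcal M,\theta)}}\mathrm{SUPP}(g[\lambda])=F(\theta)$ for all $\theta$. *)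

(* Defs.v *)
From HB Require Import structures.
From mathcomp Require Import all_boot all_order all_algebra.
From mathcomp Require Import classical_sets boolp reals constructive_ereal ereal esum.
Set Implicit Arguments. Unset Strict Implicit. Unset Printing Implicit Defensive.
Import Order.TTheory GRing.Theory Num.Theory.
Local Open Scope ring_scope.
Local Open Scope classical_set_scope.

Section Implementation.
Variable R : realType.
(* players are 'I_n, states Theta (countable), outcomes Z (finite) *)
Variables (n : nat) (Theta : countType) (Z : finType).
Variable u : 'I_n -> Theta -> Z -> R.

Definition lottery (p : Z -> R) : Prop :=
  (forall z, 0 <= p z) /\ \sum_(z : Z) p z = 1.

Definition Uexp (i : 'I_n) (th : Theta) (y : Z -> R) : R :=
  \sum_(z : Z) y z * u i th z.

Definition cdist (T : countType) (p : T -> R) : Prop :=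
  (forall t, 0 <= p t) /\ (\esum_(t in [set: T]) (p t)%:E = 1)%E.

Record mechanism := Mechanism {
  msg : 'I_n -> countType;
  outcome : {dffun forall i : 'I_n, msg i} -> Z -> R;
  outcome_lottery : forall m, lottery (outcome m) }.

Definition profile (M : mechanism) := {dffun forall i : 'I_n, msg M i}.

Definition mixed_profile (M : mechanism) := forall i : 'I_n, msg M i -> R.

Definition is_mixed (M : mechanism) (l : mixed_profile M) : Prop :=
  forall i, cdist (l i).

Definition induced (M : mechanism) (l : mixed_profile M) (z : Z) : R :=
  fine (\esum_(m in [set: profile M])
          ((\prod_(i : 'I_n) l i (m i)) * outcome m z)%:E).

Definition PNE (M : mechanism) (th : Theta) (m : profile M) : Prop :=
  forall (i : 'I_n) (m' : profile M), (forall j, j != i -> m' j = m j) ->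
    Uexp i th (outcome m') <= Uexp i th (outcome m).

Definition MNE (M : mechanism) (th : Theta) (l : mixed_profile M) : Prop :=
  is_mixed l /\
  forall (i : 'I_n) (l' : mixed_profile M), is_mixed l' ->
    (forall j, j != i -> l' j = l j) ->
    Uexp i th (induced l') <= Uexp i th (induced l).

Definition pure_eq_outcomes (M : mechanism) (th : Theta) : set Z :=
  [set z | exists m : profile M, PNE th m /\ 0 < outcome m z].

Definition mixed_eq_outcomes (M : mechanism) (th : Theta) : set Z :=
  [set z | exists l : mixed_profile M, MNE th l /\ 0 < induced l z].

Definition SCC (F : Theta -> {set Z}) : Prop := forall th, F th != finset.set0.

Definition pure_Nash_implementable (F : Theta -> {set Z}) : Prop :=
  exists M : mechanism, forall th,
    pure_eq_outcomes M th = [set z | z \in F th].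

Definition mixed_Nash_A_implementable (F : Theta -> {set Z}) : Prop :=
  exists M : mechanism, forall th,
    mixed_eq_outcomes M th = [set z | z \in F th].

Definition mixed_Nash_B_implementable (F : Theta -> {set Z}) : Prop :=
  exists M : mechanism, forall th,
    mixed_eq_outcomes M th = pure_eq_outcomes M th /\
    pure_eq_outcomes M th = [set z | z \in F th].

End Implementation.

(* Main.v *)
(* Let [M] be a mechanism whose equilibria, of the pure or of the mixed kind,
   generate [F], and let [lam s] range over a countable set of reference
   equilibria, one for each state and each outcome chosen there.  In a new
   mechanism every player reports a reference [s], or else submits a bid [k], a
   plan of deviations and a profile of [M].
   - If all report [s], the outcome is that of [lam s].
   - If all but [i] report [s], the outcome is that of [lam s] with the strategy
     of [i] replaced by the message that [i]'s plan prescribes, mixed with weight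
     1/(k+1) with the outcome of a full-support strategy of [i].
   - Otherwise the highest bidder selects a profile of [M], whose outcome is
     mixed in the same way with that of a full-support profile of [M].
   Large bids come arbitrarily close to the best payoff attainable against the
   others' reports, so each profile in the support of a mixed equilibrium gives
   every player exactly that payoff.  Because of the full-support term, this is
   possible at a disagreement only if the players concerned are indifferent
   among all the alternatives, which are then equilibrium outcomes of [M]
   themselves; at an agreement on [s] it says that [lam s] is an equilibrium of
   [M] in the current state.  In each case the outcome lies in [F].  *)
Require Import Defs.
From mathcomp Require Import all_boot all_order all_algebra.
From mathcomp Require Import classical_sets boolp reals constructive_ereal ereal esum.
From mathcomp Require Import cardinality fsbigop finmap sequences.
From mathcomp Require Import lra.
Set Implicit Arguments. Unset Strict Implicit. Unset Printing Implicit Defensive.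
Import Order.TTheory GRing.Theory Num.Theory.
Local Open Scope ring_scope.
Local Open Scope classical_set_scope.

(** * Expectations over countable distributions *)

Section Mean.
Context {R : realType}.

(** Only one inequality needs a proof: for [c != 0] the other is the same one applied to [c^-1] and
    the family [c%:E * a t]. *)
Lemma esumZl (T : choiceType) (c : R) (a : T -> \bar R) :
  0 <= c -> (forall t, 0 <= a t)%E ->
  (\esum_(t in [set: T]) (c%:E * a t) = c%:E * \esum_(t in [set: T]) a t)%E.
Proof.
move=> c0 a0; have esumZ_le (d : R) (b : T -> \bar R) :
    0 <= d -> (forall t, 0 <= b t)%E ->
    (\esum_(t in [set: T]) (d%:E * b t) <= d%:E * \esum_(t in [set: T]) b t)%E.
  move=> d0 b0; apply: ge_ereal_sup => _ /= [X fX <-].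
  rewrite fsbig_finite; last by case: fX.
  rewrite -ge0_sume_distrr; last by [].
  rewrite -fsbig_finite; last by case: fX.
  by apply: lee_wpmul2l; [rewrite lee_fin | apply: esum_ge; exists X].
apply/eqP; rewrite eq_le esumZ_le//=.
have [->|cn0] := eqVneq c 0; first by rewrite mul0e esum_ge0// => t _; rewrite mul0e.
have cp : 0 < c by rewrite lt_neqAle eq_sym cn0.
have ca0 t : (0 <= c%:E * a t)%E by rewrite mule_ge0 ?lee_fin.
have := @esumZ_le c^-1 _ _ ca0; rewrite invr_ge0 c0 => /(_ isT).
under eq_esum do rewrite muleA -EFinM mulVf// mul1e.
move=> /(@lee_wpmul2l _ c%:E); rewrite lee_fin c0 => /(_ isT).
by rewrite [leRHS]muleA -EFinM mulfV// mul1e.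
Qed.

Context {T : countType}.
Implicit Types (p f g : T -> R) (v w B C : R).

Lemma cdist_esum_fin p f C : cdist p -> (forall t, 0 <= f t <= C) ->
  exists v, (\esum_(t in [set: T]) (p t * f t)%:E = v%:E)%E.
Proof.
move=> [p0 p1] fC.
have : (0 <= \esum_(t in [set: T]) (p t * f t)%:E)%E.
  by apply: esum_ge0 => t _; rewrite lee_fin mulr_ge0//; case/andP: (fC t).
suff: (\esum_(t in [set: T]) (p t * f t)%:E <= `|C|%:E)%E.
  by case: (\esum_(_ in _) _)%E => [r _ _||]; [exists r|rewrite leye_eq|rewrite leeNy_eq].
rewrite -[leRHS]mule1 -p1 -esumZl//.
apply: le_esum => t _; rewrite -EFinM lee_fin mulrC ler_wpM2r//.
by case/andP: (fC t) => _ /le_trans; apply; exact: ler_norm.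
Qed.

Lemma cdist_inhabited p : cdist p -> exists t : T, True.
Proof.
move=> [_ p1]; apply: contrapT => T0; move: p1; rewrite esum1 => [/eqP|t _].
  by rewrite eq_sym onee_eq0.
by case: T0; exists t.
Qed.

(* The expectation of a bounded signed function: since [esum] is meaningful
   for nonnegative terms only, [f] is shifted by a bound. *)
Definition mean p f v := exists C, (forall t, `|f t| <= C) /\
  (\esum_(t in [set: T]) (p t * (f t + C))%:E = (v + C)%:E)%E.

Section Dist.
Variable p : T -> R.
Hypothesis pd : cdist p.

Let p0 t : 0 <= p t. Proof. by case: pd. Qed.

Let shift_ge0 f C t : (forall t, `|f t| <= C) -> 0 <= f t + C.
Proof. by move=> /(_ t); rewrite ler_norml => /andP[+ _]; rewrite -lerBlDr sub0r. Qed.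

Lemma esum_shift f v D : (forall t, 0 <= f t) -> 0 <= D ->
  (\esum_(t in [set: T]) (p t * f t)%:E = v%:E)%E ->
  (\esum_(t in [set: T]) (p t * (f t + D))%:E = (v + D)%:E)%E.
Proof.
move=> f0 D0 fv; under eq_esum do rewrite mulrDr EFinD.
rewrite esumD; first last.
- by move=> t _; rewrite lee_fin mulr_ge0.
- by move=> t _; rewrite lee_fin mulr_ge0.
rewrite fv; under eq_esum do rewrite mulrC EFinM.
rewrite esumZl//.
by case: pd => _ ->; rewrite mule1.
Qed.

(** Any bound of [f] can replace the one hidden in [mean]. A larger one shifts the sum by
    [esum_shift]; for a smaller one, the sum is first seen to be finite and then shifted up to the
    known one. *)
Lemma mean_shift f v C : mean p f v -> (forall t, `|f t| <= C) ->
  (\esum_(t in [set: T]) (p t * (f t + C))%:E = (v + C)%:E)%E.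
Proof.
move=> [D [fD fv]] fC.
have [DC|/ltW CD] := leP D C.
  have := esum_shift (fun t => shift_ge0 t fD) _ fv.
  move=> /(_ (C - D)); rewrite subr_ge0 => /(_ DC).
  by under eq_esum do rewrite -addrA subrKC; rewrite -addrA subrKC.
have [w fw] : exists w, (\esum_(t in [set: T]) (p t * (f t + C))%:E = w%:E)%E.
  apply: (@cdist_esum_fin _ _ (C + C)) => // t; rewrite shift_ge0//= lerD2r.
  by apply: le_trans (fC t); exact: ler_norm.
have := esum_shift (fun t => shift_ge0 t fC) _ fw.
move=> /(_ (D - C)); rewrite subr_ge0 => /(_ CD).
under eq_esum do rewrite -addrA subrKC.
by rewrite fv fw => -[vD]; congr (_%:E); lra.
Qed.

Lemma mean_exists f C : (forall t, `|f t| <= C) -> exists v, mean p f v.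
Proof.
move=> fC; have [|w fw] := @cdist_esum_fin p (fun t => f t + C) (C + C) pd.
  by move=> t; rewrite shift_ge0//= lerD2r; apply: le_trans (fC t); exact: ler_norm.
by exists (w - C), C; split => //; rewrite subrK.
Qed.

Lemma mean_ge0 f v : mean p f v -> (forall t, 0 <= f t) -> 0 <= v.
Proof.
move=> [C [fC fv]] f0; rewrite -(lerD2r C) add0r -lee_fin -fv.
have [t0 _] := cdist_inhabited pd.
have C0 : 0 <= C by apply: le_trans (fC t0).
have := pd.2 => p1; rewrite -[leLHS]mule1 -p1 -esumZl//.
by apply: le_esum => s _; rewrite -EFinM lee_fin mulrC ler_wpM2l// lerDr.
Qed.

Lemma meanD f g v w : mean p f v -> mean p g w ->
  mean p (fun t => f t + g t) (v + w).
Proof.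
move=> [C [fC fv]] [D [gD gw]]; exists (C + D); split=> [t|].
  by apply: le_trans (ler_normD _ _) _; exact: lerD.
under eq_esum do rewrite addrACA mulrDr EFinD.
rewrite esumD ?fv ?gw -?EFinD 1?addrACA// => t _;
  by rewrite lee_fin mulr_ge0 ?shift_ge0.
Qed.

Lemma mean_cst v : mean p (fun=> v) v.
Proof.
exists `|v|; split=> //; under eq_esum do rewrite mulrC EFinM.
rewrite esumZl ?pd.2 ?mule1//.
by rewrite -lerBlDr sub0r lerNl -normrN ler_norm.
Qed.

Lemma mean_uniq f v w : mean p f v -> mean p f w -> v = w.
Proof. by move=> + [C [fC fw]] => /mean_shift/(_ fC); rewrite fw => -[] /addIr. Qed.

(** Sums of nonnegative terms cannot be negated directly. Instead, a mean of [- f] exists by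
    boundedness, and added to [v] it is a mean of [0]. *)
Lemma meanN f v : mean p f v -> mean p (fun t => - f t) (- v).
Proof.
move=> mf; have [C [fC _]] := mf.
have [|w mg] := @mean_exists (fun t => - f t) C; first by move=> t; rewrite normrN.
have /mean_uniq/(_ (mean_cst 0)) : mean p (fun=> 0) (v + w).
  by have := meanD mf mg; under eq_fun do rewrite subrr.
by move=> /eqP; rewrite addr_eq0 => /eqP ->; rewrite opprK.
Qed.

Lemma meanB f g v w : mean p f v -> mean p g w ->
  mean p (fun t => f t - g t) (v - w).
Proof. by move=> mf /meanN; exact: meanD. Qed.

Lemma le_mean f g v w : mean p f v -> mean p g w ->
  (forall t, f t <= g t) -> v <= w.
Proof.
move=> mf mg fg; rewrite -subr_ge0; apply: (mean_ge0 (meanB mg mf)) => t.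
by rewrite subr_ge0.
Qed.

Lemma meanZ c f v : mean p f v -> mean p (fun t => c * f t) (c * v).
Proof.
wlog c0 : c / 0 <= c => [H mf|[C [fC fv]]].
  have [/H|/ltW c0] := leP 0 c; first exact.
  have := meanN (H (- c) _ mf); rewrite oppr_ge0 mulNr opprK => /(_ c0).
  by under eq_fun do rewrite mulNr opprK.
exists (c * C); split=> [t|]; first by rewrite normrM ger0_norm// ler_wpM2l.
under eq_esum do rewrite -mulrDr mulrCA EFinM.
rewrite esumZl// ?fv -?EFinM ?mulrDr// => t.
by rewrite lee_fin mulr_ge0 ?shift_ge0.
Qed.

Lemma mean_sum (I : Type) (r : seq I) (f : I -> T -> R) (v : I -> R) :
  (forall i, mean p (f i) (v i)) ->
  mean p (fun t => \sum_(i <- r) f i t) (\sum_(i <- r) v i).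
Proof.
move=> fv; elim: r => [|i r IHr].
  by under eq_fun do rewrite big_nil; rewrite big_nil; exact: mean_cst.
by under eq_fun do rewrite big_cons; rewrite big_cons; exact: meanD.
Qed.

Lemma mean_pred1 t0 : mean p (fun t => (t == t0)%:R) (p t0).
Proof.
suff H : (\esum_(t in [set: T]) (p t * (t == t0)%:R)%:E = (p t0)%:E)%E.
  exists 1; split=> [t|]; first by case: (t == t0); rewrite ?normr0 ?normr1.
  by apply: esum_shift H => // t; rewrite ler0n.
rewrite (esumID [set t0])//; last by move=> t _; rewrite lee_fin mulr_ge0.
rewrite setTI esum_set1 ?eqxx ?mulr1// ?lee_fin//.
by rewrite esum1 ?adde0// => t [_ /eqP/negPf ->]; rewrite mulr0.
Qed.

Lemma mean_gt0 f v : mean p f v -> (forall t, 0 <= f t) -> 0 < v ->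
  exists t, 0 < p t /\ 0 < f t.
Proof.
move=> mf f0 v0; apply: contrapT => pf0; have [C [fC fv]] := mf.
suff /mean_uniq/(_ (mean_cst 0)) v0' : mean p (fun=> 0) v by rewrite v0' ltxx in v0.
have [t0 _] := cdist_inhabited pd.
exists C; split=> [_|]; first by rewrite normr0 (le_trans _ (fC t0)).
rewrite -fv; apply: eq_esum => t _; rewrite !mulrDr mulr0; congr (_ + _)%:E.
have [pt|] := ltP 0 (p t); last first.
  by move=> pt; rewrite (_ : p t = 0) ?mul0r//; apply/eqP; rewrite eq_le pt p0.
have [ft|ft] := ltP 0 (f t); first by case: pf0; exists t.
by rewrite (_ : f t = 0) ?mulr0//; apply/eqP; rewrite eq_le ft f0.
Qed.

Lemma mean_le_cst f v B : mean p f v -> (forall t, f t <= B) -> v <= B.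
Proof. by move=> mf; exact: le_mean mf (mean_cst B). Qed.

(** If [f t < B] at a point of positive mass, raising [f] to [B] there would respect the bound [B]
    and yet push the mean above it. *)
Lemma mean_ge_cst f v B : mean p f v -> (forall t, f t <= B) -> B <= v ->
  forall t, 0 < p t -> f t = B.
Proof.
move=> mf fB Bv t pt; apply/eqP; rewrite eq_le fB/= leNgt; apply/negP => ftB.
have : 0 < (B - f t) * p t by rewrite mulr_gt0// subr_gt0.
suff : v + (B - f t) * p t <= B by lra.
apply: le_mean (meanD mf (meanZ (B - f t) (mean_pred1 t))) (mean_cst B) _ => s.
by have [->|st] := eqVneq s t; [rewrite mulr1 subrKC | rewrite mulr0 addr0].
Qed.

Lemma cdist_tight eps : 0 < eps ->
  exists A : seq T, uniq A /\ 1 - eps <= \sum_(t <- A) p t.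
Proof.
move=> e0; have [_ p1] := pd.
have : ((1 - eps)%:E < \esum_(t in [set: T]) (p t)%:E)%E.
  by rewrite p1 lte_fin gtrBl.
move=> /ereal_sup_gt[_ /= [X [finX _] <-]].
rewrite fsbig_finite//= sumEFin lte_fin => /ltW H.
by exists (fset_set X); split => //; exact: fset_uniq.
Qed.

(* [W] is an upper bound of the payoff [f] that alternative payoffs [g] of no
   larger mean approach uniformly on finite sets; since finitely many points
   carry almost all the mass, [f] meets the bound wherever [p] is positive. *)
Lemma mean_attained f v W C : mean p f v -> (forall t, `|f t| <= C) ->
  (forall t, f t <= W t) ->
  (forall (A : seq T) eps, 0 < eps -> exists g w, [/\ mean p g w,
     (forall t, `|g t| <= C), w <= v & forall t, t \in A -> W t - eps <= g t]) ->
  forall t, 0 < p t -> f t = W t.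
Proof.
move=> mf fC fW gW t0 pt0; apply/eqP; rewrite eq_le fW/= leNgt; apply/negP => ft0.
have C0 : 0 <= C by apply: le_trans (fC t0).
pose d := W t0 - f t0; have d0 : 0 < d by rewrite subr_gt0.
have dp0 : 0 < d * p t0 by rewrite mulr_gt0.
(* Chosen so that the total loss [eps * (1 + 2 * C)] is only half of the gain [d * p t0]. *)
pose eps := d * p t0 / (2 * (1 + 2 * C)).
have e0 : 0 < eps by rewrite divr_gt0//; lra.
have [A [uA pA]] := cdist_tight e0.
have [g [w [mg gC wv gA]]] := gW (t0 :: A) eps e0.
have mA := mean_sum A mean_pred1.
have mrhs := meanD mg (meanD (mean_cst eps) (meanZ (2 * C) (meanB (mean_cst 1) mA))).
have mlhs := meanD mf (meanZ d (mean_pred1 t0)).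
have : eps * (1 + 2 * C) = d * p t0 / 2.
  by rewrite /eps invfM -!mulrA mulVf ?mulr1//; lra.
(* This comes from a pointwise comparison: on [A], [g] falls short of [W] by at most [eps]; off [A],
   [f] and [g] differ by at most [2 * C]; at [t0], the term [d] lifts [f] to [W]. *)
suff : v + d * p t0 <= w + (eps + 2 * C * (1 - \sum_(t <- A) p t)) by nra.
apply: le_mean mlhs mrhs _ => t /=.
have -> : \sum_(i <- A) (t == i)%:R = (t \in A)%:R :> R.
  elim: A uA {pA mA gA} => [|a A IHA] /=; first by rewrite big_nil.
  move=> /andP[aA /IHA]; rewrite big_cons inE => ->.
  by have [->|] := eqVneq t a; rewrite ?(negPf aA) ?addr0 ?add0r.
have := fW t; have := fC t; have := gC t; rewrite !ler_norml => /andP[? ?] /andP[? ?] ?.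
have [->|tt0] := eqVneq t t0.
  rewrite mulr1 /d; have := gA t0; rewrite mem_head => /(_ isT) ?.
  case: (t0 \in A); rewrite /= ?subrr ?subr0 ?mulr0 ?mulr1; lra.
rewrite mulr0; have [tA|tA] := boolP (t \in A); last by rewrite subr0 mulr1; lra.
by have := gA t; rewrite inE tA orbT => /(_ isT) ?; rewrite subrr mulr0; lra.
Qed.

End Dist.
End Mean.

(** * Product distributions *)

Section Product.
Context {R : realType}.

Lemma esum_swap (T U : choiceType) (a : T -> U -> \bar R) :
  (forall t s, 0 <= a t s)%E ->
  (\esum_(t in [set: T]) \esum_(s in [set: U]) a t s =
   \esum_(s in [set: U]) \esum_(t in [set: T]) a t s)%E.
Proof.
move=> a0; rewrite !esum_esum//.
rewrite (reindex_esum ([set: U] `*`` (fun=> [set: T])) _ (fun x => (x.2, x.1)))//.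
by split=> [//|[? ?] [? ?] _ _ [-> ->] //|[t s] _]; exists (s, t).
Qed.

Lemma esum_support (T : choiceType) (D : set T) (a : T -> \bar R) :
  (forall t, 0 <= a t)%E -> (forall t, ~ D t -> a t = 0%E) ->
  \esum_(t in [set: T]) a t = \esum_(t in D) a t.
Proof.
move=> a0 aD; rewrite (esumID D)// setTI [X in (_ + X)%E]esum1 ?adde0//.
by move=> t [_ /aD].
Qed.

Lemma esum_point (T : choiceType) t0 (a : T -> \bar R) :
  (0 <= a t0)%E -> (forall t, t != t0 -> a t = 0%E) ->
  \esum_(t in [set: T]) a t = a t0.
Proof.
move=> a0 aN; rewrite (@esum_support _ [set t0]) ?esum_set1// => t.
  by have [->//|/aN ->] := eqVneq t t0.
by move=> /eqP/aN.
Qed.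

Definition dirac (T : eqType) (a t : T) : R := (t == a)%:R.

Lemma dirac_id (T : eqType) (a : T) : dirac a a = 1.
Proof. by rewrite /dirac eqxx. Qed.

Lemma dirac_neq (T : eqType) (a t : T) : t != a -> dirac a t = 0.
Proof. by rewrite /dirac => /negPf ->. Qed.

Lemma dirac_ge0 (T : eqType) (a t : T) : 0 <= dirac a t.
Proof. exact: ler0n. Qed.

Lemma cdist_dirac (T : countType) (a : T) : cdist (dirac a).
Proof.
split=> [|]; first exact: dirac_ge0.
by rewrite (@esum_point _ a) ?dirac_id// => t /dirac_neq ->.
Qed.

Lemma mean_dirac (T : countType) (a : T) (f : T -> R) v :
  mean (dirac a) f v -> v = f a.
Proof.
move=> [C [fC]]; rewrite (@esum_point _ a).
- by rewrite dirac_id mul1r => -[/addIr].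
- rewrite dirac_id mul1r lee_fin -lerBlDr sub0r.
  by have := fC a; rewrite ler_norml => /andP[].
- by move=> t /dirac_neq ->; rewrite mul0r.
Qed.

Context {I : finType} {X : I -> countType}.
Implicit Types (l : forall i, X i -> R) (m : {dffun forall i, X i}).
Implicit Types (f : {dffun forall i, X i} -> R) (v C : R).

Definition prodd l m : R := \prod_i l i (m i).

Definition upd m i (d : X i) : {dffun forall i, X i} := finfun (dfwith m d).

Lemma upd_in m i (d : X i) : upd m d i = d.
Proof. by rewrite ffunE dfwith_in. Qed.

Lemma upd_out m i (d : X i) j : j != i -> upd m d j = m j.
Proof. by move=> ji; rewrite ffunE dfwith_out// eq_sym. Qed.

Lemma upd_unique m m' i : (forall j, j != i -> m' j = m j) -> m' = upd m (m' i).
Proof.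
move=> mm'; apply/ffunP => j; have [->|/[dup] ji /mm' ->] := eqVneq j i.
  by rewrite upd_in.
by rewrite upd_out.
Qed.

Lemma prodd_ge0 l m : (forall i d, 0 <= l i d) -> 0 <= prodd l m.
Proof. by move=> l0; apply: prodr_ge0. Qed.

Lemma prodd_dfwith l i (q : X i -> R) m :
  prodd (dfwith l q) m = q (m i) * \prod_(j | j != i) l j (m j).
Proof.
rewrite /prodd (bigD1 i)//= dfwith_in; congr (_ * _).
by apply: eq_bigr => j ji; rewrite dfwith_out// eq_sym.
Qed.

Lemma dfwith_ge0 l i (q : X i -> R) : (forall d, 0 <= q d) ->
  (forall j d, 0 <= l j d) -> forall j d, 0 <= dfwith l q j d.
Proof. by move=> q0 l0 j; case: dfwithP. Qed.

Lemma dfwith_cdist l i (q : X i -> R) : cdist q ->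
  (forall j, cdist (l j)) -> forall j, cdist (dfwith l q j).
Proof. by move=> qd ld j; case: dfwithP. Qed.

(** Conditioning on the draw of [i]: after the sums are exchanged, only [d = m i] survives for each
    [m]. *)
Lemma esum_prodd_split l i (h : {dffun forall i, X i} -> R) :
  (forall j d, 0 <= l j d) -> (forall m, 0 <= h m) ->
  (\esum_(m in [set: {dffun forall i, X i}]) (prodd l m * h m)%:E =
   \esum_(d in [set: X i]) ((l i d)%:E *
     \esum_(m in [set: {dffun forall i, X i}])
        (prodd (dfwith l (dirac d)) m * h m)%:E))%E.
Proof.
move=> l0 h0; have P0 d m : 0 <= prodd (dfwith l (dirac d)) m * h m.
  by rewrite mulr_ge0// prodd_ge0//; exact/dfwith_ge0/l0/dirac_ge0.
rewrite [RHS](eq_esum (b := fun d => \esum_(m in [set: {dffun forall i, X i}])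
    ((l i d)%:E * (prodd (dfwith l (dirac d)) m * h m)%:E)%E)); last first.
  by move=> d _; rewrite -esumZl// => m; rewrite lee_fin.
rewrite esum_swap; last by move=> d m; rewrite -EFinM lee_fin mulr_ge0.
apply: eq_esum => m _; rewrite (@esum_point _ (m i)).
- by rewrite -EFinM prodd_dfwith dirac_id mul1r /prodd (bigD1 i)//= mulrA.
- by rewrite -EFinM lee_fin mulr_ge0.
- by move=> d dm; rewrite prodd_dfwith dirac_neq 1?eq_sym// !mul0r mule0.
Qed.

Lemma prodd_dirac m : prodd (fun i => dirac (m i)) = dirac m.
Proof.
apply/funext => m'; have [->|mm'] := eqVneq m' m.
  by rewrite dirac_id /prodd big1// => i _; rewrite dirac_id.
rewrite dirac_neq//; have [i im] : exists i, m' i != m i.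
  apply: contra_notP (elimN eqP mm') => H; apply/ffunP => i.
  by apply: contra_notP H => /eqP; exists i.
by rewrite /prodd (bigD1 i)//= dirac_neq// mul0r.
Qed.

(** Induction on a list containing every index whose distribution is not a point mass: conditioning
    on one draw shortens the list, and the empty list leaves a single pure profile. *)
Lemma cdist_prodd l : (forall i, cdist (l i)) -> cdist (prodd l).
Proof.
move=> ld; split=> [m|]; first by apply: prodd_ge0 => i d; case: (ld i).
have : forall i, i \notin enum I -> exists d, l i = dirac d.
  by move=> i; rewrite mem_enum.
elim: (enum I) l ld => [|i r IHr] l ld lr.
  have lm i := cid (lr i isT).
  pose m : {dffun forall i, X i} := finfun (fun i => projT1 (lm i)).
  have -> : l = fun i => dirac (m i).
    by apply: functional_extensionality_dep => i; rewrite ffunE; case: (lm i).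
  by rewrite prodd_dirac; case: (cdist_dirac m).
under eq_esum do rewrite -[prodd _ _]mulr1.
rewrite (@esum_prodd_split l i)//; last by move=> j d; case: (ld j).
have [_ <-] := ld i; apply: eq_esum => d _.
under eq_esum do rewrite mulr1.
rewrite IHr ?mule1//; first exact/dfwith_cdist/ld/cdist_dirac.
move=> j jr; have [<-|ij] := eqVneq i j; first by rewrite dfwith_in; exists d.
by rewrite dfwith_out//; apply: lr; rewrite inE negb_or eq_sym ij.
Qed.

(** The law of total expectation, [w d] being the expectation conditional on [i] drawing [d]. *)
Lemma mean_split l i f v (w : X i -> R) : (forall j, cdist (l j)) ->
  mean (prodd l) f v ->
  (forall d, mean (prodd (dfwith l (dirac d))) f (w d)) -> mean (l i) w v.
Proof.
move=> ld [C [fC fv]] fw.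
have ldd (d : X i) := cdist_prodd (dfwith_cdist (cdist_dirac d) ld).
exists C; split=> [d|].
  rewrite ler_norml; apply/andP; split.
    rewrite lerNl; apply: (mean_le_cst (ldd d) (meanN (ldd d) (fw d))) => m.
    by rewrite lerNl; have := fC m; rewrite ler_norml => /andP[].
  apply: (mean_le_cst (ldd d) (fw d)) => m.
  by have := fC m; rewrite ler_norml => /andP[].
rewrite -fv (@esum_prodd_split l i).
- apply: eq_esum => d _; rewrite EFinM; congr (_ * _)%E.
  by rewrite (mean_shift (ldd d) (fw d) fC).
- by move=> j d; case: (ld j).
- by move=> m; have := fC m; rewrite ler_norml -subr_ge0 opprK addrC => /andP[].
Qed.

(** The draw of [i] is overwritten by [c]: [upd] carries the profiles with [m i = d] bijectively
    onto those with [m i = c] and keeps the weight of the other coordinates. *)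
Lemma mean_upd l i (c : X i) f v : (forall j, cdist (l j)) ->
  mean (prodd (dfwith l (dirac c))) f v -> mean (prodd l) (fun m => f (upd m c)) v.
Proof.
move=> ld [C [fC fv]]; exists C; split=> [m|]; first exact: fC.
have l0 j d : 0 <= l j d by case: (ld j).
have fC0 m : 0 <= f m + C.
  by have := fC m; rewrite ler_norml -subr_ge0 opprK addrC => /andP[].
have P0 d m g : 0 <= g -> 0 <= prodd (dfwith l (dirac d)) m * g.
  move=> g0; rewrite mulr_ge0// prodd_ge0//; exact/dfwith_ge0/l0/dirac_ge0.
have PN d m g : ~ m i = d -> (prodd (dfwith l (dirac d)) m * g)%:E = 0%E.
  by move=> /eqP md; rewrite prodd_dfwith dirac_neq// !mul0r.
rewrite (@esum_prodd_split l i)//.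
rewrite (eq_esum (b := fun d => (v + C)%:E * (l i d)%:E)%E).
  rewrite esumZl; [by case: (ld i) => _ ->; rewrite mule1| |by move=> d; rewrite lee_fin].
  by rewrite -lee_fin -fv esum_ge0// => m _; rewrite lee_fin P0.
move=> d _; rewrite muleC; congr (_ * _)%E.
rewrite -fv (@esum_support _ [set m : {dffun forall i, X i} | m i = d]); first last.
- by move=> m; exact: PN.
- by move=> m; rewrite lee_fin P0.
rewrite [RHS](@esum_support _ [set m : {dffun forall i, X i} | m i = c]); first last.
- by move=> m; exact: PN.
- by move=> m; rewrite lee_fin P0.
rewrite (reindex_esum [set m : {dffun forall i, X i} | m i = d]
  [set m : {dffun forall i, X i} | m i = c] (fun m => upd m c)).
  apply: eq_esum => m /= md; rewrite !prodd_dfwith upd_in md !dirac_id.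
  by under [in RHS]eq_bigr => j ji do rewrite upd_out//.
split=> [m _ /=|m m' /set_mem/= md /set_mem/= m'd mm'|m /= mc]; first exact: upd_in.
  rewrite (@upd_unique m' m i) ?md -?m'd -?(@upd_unique _ m' i)// => j ji.
  by rewrite -(upd_out m c ji) mm' upd_out.
exists (upd m d); first exact: upd_in.
apply/ffunP => j; have [->|ji] := eqVneq j i; first by rewrite upd_in.
by rewrite !upd_out.
Qed.

End Product.

Lemma dfwith_dfwith (I : eqType) (X : I -> Type) (l : forall i, X i) i
  (x y : X i) : dfwith (dfwith l x) y = dfwith l y.
Proof.
apply: functional_extensionality_dep => j; have [<-|ij] := eqVneq i j.
  by rewrite !dfwith_in.
by rewrite !dfwith_out.
Qed.

Lemma dfwith_self (I : eqType) (X : I -> Type) (l l' : forall i, X i) i :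
  (forall j, j != i -> l' j = l j) -> l' = dfwith l (l' i).
Proof.
move=> ll'; apply: functional_extensionality_dep => j.
have [<-|ij] := eqVneq i j; first by rewrite dfwith_in.
by rewrite dfwith_out// ll'// eq_sym.
Qed.

(** * Equilibria in mixed profiles *)

Section Lotteries.
Context {R : realType} {n : nat} {Theta : countType} {Z : finType}.
Variable u : 'I_n -> Theta -> Z -> R.
Implicit Types (i : 'I_n) (th : Theta) (p q : Z -> R).

Definition mix (e : R) p q : Z -> R := fun z => e * p z + (1 - e) * q z.

Lemma lottery_mix e p q : 0 <= e <= 1 -> lottery p -> lottery q ->
  lottery (mix e p q).
Proof.
move=> /andP[e0 e1] [p0 p1] [q0 q1]; split=> [z|].
  by rewrite addr_ge0// mulr_ge0// subr_ge0.
by rewrite big_split/= -!mulr_sumr p1 q1 !mulr1 subrKC.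
Qed.

Lemma Uexp_mix i th e p q :
  Uexp u i th (mix e p q) = e * Uexp u i th p + (1 - e) * Uexp u i th q.
Proof.
rewrite /Uexp !mulr_sumr -big_split/=; apply: eq_bigr => z _.
by rewrite mulrDl !mulrA.
Qed.

Lemma lottery_le1 p z : lottery p -> p z <= 1.
Proof.
by move=> [p0 <-]; rewrite (bigD1 z)//= lerDl sumr_ge0.
Qed.

Definition Ubound i th : R := \sum_z `|u i th z|.

Lemma Uexp_bounded i th p : lottery p -> `|Uexp u i th p| <= Ubound i th.
Proof.
move=> pl; apply: le_trans (ler_norm_sum _ _ _) _; apply: ler_sum => z _.
by rewrite normrM ger0_norm ?ler_piMl// ?lottery_le1//; case: pl.
Qed.

End Lotteries.

Section Mechanisms.
Context {R : realType} {n : nat} {Theta : countType} {Z : finType}.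
Variable u : 'I_n -> Theta -> Z -> R.
Variable M : mechanism R n Z.
Implicit Types (l : mixed_profile M) (m : profile M) (th : Theta) (i : 'I_n).

Definition pure m : mixed_profile M := fun i => dirac (m i).

Lemma is_mixed_pure m : is_mixed (pure m).
Proof. by move=> i; exact: cdist_dirac. Qed.

Lemma is_mixed_dirac l i (d : msg M i) : is_mixed l ->
  is_mixed (dfwith l (dirac d) : mixed_profile M).
Proof. exact/dfwith_cdist/cdist_dirac. Qed.

Lemma pure_upd m i (d : msg M i) : dfwith (pure m) (dirac d) = pure (upd m d).
Proof.
apply: functional_extensionality_dep => j; have [<-|ij] := eqVneq i j.
  by rewrite dfwith_in /pure upd_in.
by rewrite dfwith_out// /pure upd_out// eq_sym.
Qed.

Lemma mean_induced l z : is_mixed l ->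
  mean (prodd l) (fun m => outcome m z) (induced l z).
Proof.
move=> lm; have ld := cdist_prodd lm; exists 1; split=> [m|].
  have [o0 _] := outcome_lottery m.
  by rewrite ger0_norm// lottery_le1//; exact: outcome_lottery.
apply: esum_shift => // [m|]; first by case: (outcome_lottery m).
have [|v ov] := @cdist_esum_fin _ _ _ (fun m => outcome m z) 1 ld.
  move=> m; rewrite lottery_le1 ?andbT; last exact: outcome_lottery.
  by case: (outcome_lottery m).
by rewrite ov /induced [X in fine X]ov.
Qed.

Lemma lottery_induced l : is_mixed l -> lottery (induced l).
Proof.
move=> lm; have ld := cdist_prodd lm; split=> [z|].
  by apply: (mean_ge0 ld (mean_induced z lm)) => m; case: (outcome_lottery m).
have H := mean_sum ld (index_enum Z) (fun z => mean_induced z lm).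
apply: (mean_uniq ld H); rewrite (_ : (fun=> _) = fun=> 1); first exact: mean_cst.
by apply/funext => m; case: (outcome_lottery m).
Qed.

Lemma mean_Uexp l i th : is_mixed l ->
  mean (prodd l) (fun m => Uexp u i th (outcome m)) (Uexp u i th (induced l)).
Proof.
move=> lm; have ld := cdist_prodd lm; apply: mean_sum => // z.
rewrite mulrC; under eq_fun do rewrite mulrC.
exact/meanZ/mean_induced.
Qed.

Lemma mean_induced_dev l z i : is_mixed l ->
  mean (l i) (fun d => induced (dfwith l (dirac d) : mixed_profile M) z) (induced l z).
Proof.
move=> lm; apply: (mean_split lm (mean_induced z lm)) => d.
exact/mean_induced/is_mixed_dirac.
Qed.

Lemma mean_Uexp_dev l i j th : is_mixed l ->
  mean (l i) (fun d => Uexp u j th (induced (dfwith l (dirac d) : mixed_profile M)))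
    (Uexp u j th (induced l)).
Proof.
move=> lm; apply: (mean_split lm (mean_Uexp j th lm)) => d.
exact/mean_Uexp/is_mixed_dirac.
Qed.

Lemma induced_pure m : induced (pure m) = outcome m.
Proof.
apply/funext => z; have := mean_induced z (is_mixed_pure m).
by rewrite prodd_dirac => /mean_dirac.
Qed.

(** A mixed deviation pays the mean of what its messages pay one by one, hence no more than a common
    bound of these. *)
Lemma MNE_dirac_dev th l : is_mixed l ->
  (forall i (d : msg M i), Uexp u i th (induced (dfwith l (dirac d) : mixed_profile M))
     <= Uexp u i th (induced l)) <-> MNE u th l.
Proof.
move=> lm; split=> [H|[_ H] i d]; last first.
  apply: H => [|j ji]; first exact: is_mixed_dirac.
  by rewrite dfwith_out// eq_sym.
split=> // i l' lm' Hl; have ll' := dfwith_self Hl.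
apply: (mean_le_cst (lm' i) (mean_Uexp_dev i i th lm')) => d.
by rewrite ll' dfwith_dfwith.
Qed.

Lemma PNE_MNE th m : PNE u th m <-> MNE u th (pure m).
Proof.
rewrite -MNE_dirac_dev; last exact: is_mixed_pure.
rewrite induced_pure; split=> H i => [d|m' /upd_unique ->].
  by rewrite pure_upd induced_pure; apply: H => j; exact: upd_out.
by have := H i (m' i); rewrite pure_upd induced_pure.
Qed.

Lemma pure_sub_mixed th : pure_eq_outcomes u M th `<=` mixed_eq_outcomes u M th.
Proof.
by move=> z [m [/PNE_MNE me mz]]; exists (pure m); rewrite induced_pure.
Qed.

End Mechanisms.

(** * The mechanism of references, plans and bids *)

Section Sup.
Context {R : realType} {T : Type}.
Implicit Types (f : T -> R) (B : R).

Definition fsup f : R := sup (range f).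

Lemma le_fsup f B t : (forall t, f t <= B) -> f t <= fsup f.
Proof. by move=> fB; apply: ub_le_sup; [exists B => _ [s _ <-] | exists t]. Qed.

Lemma fsup_le f B : T -> (forall t, f t <= B) -> fsup f <= B.
Proof. by move=> t fB; apply: ge_sup => [|_ [s _ <-]//]; exists (f t), t. Qed.

Lemma fsup_adherent f B eps : T -> (forall t, f t <= B) -> 0 < eps ->
  exists t, fsup f - eps <= f t.
Proof.
move=> t fB e0; have [|_ [s _ <-] /ltW] := @sup_adherent _ (range f) _ e0.
  by split; [exists (f t), t | exists B => _ [s _ <-]].
by exists s.
Qed.

End Sup.

Section Construction.
Context {R : realType} {n : nat} {Theta : countType} {Z : finType}.
Variable u : 'I_n -> Theta -> Z -> R.
Hypothesis n3 : (3 <= n)%N.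
Variables (M : mechanism R n Z) (x0 : profile M) (w : mixed_profile M).
Arguments w : clear implicits.
Hypotheses (wm : is_mixed w) (w0 : forall (i : 'I_n) (d : msg M i), 0 < w i d).
Variables (S : countType) (lam : S -> mixed_profile M).
Arguments lam : clear implicits.
Hypothesis lamm : forall s, is_mixed (lam s).

Local Notation ind l := (induced (l : mixed_profile M)).

Definition yref s := ind (lam s).
Definition yalt i (d : msg M i) s := ind (dfwith (lam s) (dirac d)).
Definition ymix i s := ind (dfwith (lam s) (w i)).

Definition rmsg (i : 'I_n) : countType :=
  (S + nat * seq (msg M i) * profile M)%type.
Definition rprofile := {dffun forall i, rmsg i}.
Implicit Types (m : rprofile) (i j : 'I_n) (s : S).

Definition weight (k : nat) : R := k.+1%:R^-1.

(* The plan lists deviation messages by the index [pickle s] of the reference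
   equilibrium, so that the set of messages remains countable. *)
Definition deviate i s (t : rmsg i) : Z -> R :=
  match t with
  | inl _ => ymix i s
  | inr (k, plan, _) =>
      mix (weight k) (ymix i s) (yalt (nth (x0 i) plan (choice.pickle s)) s)
  end.

(** A reference counts as [0] and a bid [k] as [k.+1], so that every actual bid beats every
    reference. *)
Definition bid i (t : rmsg i) : nat :=
  match t with inl _ => 0 | inr (k, _, _) => k.+1 end.

(** The winner must be strictly highest; a tie at the top gives the full-support outcome [ind w]. *)
Definition compete m : Z -> R :=
  if [pick i | [forall j, (j != i) ==> (bid (m j) < bid (m i))%N]] is Some i
  then match m i with
       | inl _ => ind w
       | inr (k, _, x) => mix (weight k) (ind w) (outcome x)
       end
  else ind w.

Definition unanimous m s := forall j, m j = inl s.
Definition agree m i s := forall j, j != i -> m j = inl s.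

(** The witnesses are picked by choice; with at least three players, [agree_uniq] and [agree_other]
    make the outcome independent of the pick. *)
Definition routcome m : Z -> R :=
  if pselect (exists s, unanimous m s) is left e then yref (projT1 (cid e))
  else if pselect (exists p, agree m p.1 p.2) is left e then
    let p := projT1 (cid e) in deviate p.2 (m p.1)
  else compete m.

Lemma third i j : exists k, k != i /\ k != j.
Proof.
suff /card_gt0P[k] : (0 < #|(~: [set i; j])%SET|)%N.
  by rewrite !inE negb_or => /andP[]; exists k.
rewrite lt0n; apply/eqP => C0; have := cardsC [set i; j]%SET.
rewrite C0 addn0 cards2 card_ord => n2; move: n3; rewrite -n2.
by case: (i != j).
Qed.

(** With at least three players, someone is bound by both agreements. *)
Lemma agree_uniq m i j s s' : agree m i s -> agree m j s' -> s = s'.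
Proof.
move=> mi mj; have [k [ki kj]] := third i j.
by have := mi k ki; rewrite mj// => -[].
Qed.

Lemma agree_other m i j s s' : agree m i s -> agree m j s' -> i != j ->
  unanimous m s.
Proof.
move=> mi mj ij k; have [->|/mi//] := eqVneq k i.
by rewrite (agree_uniq mi mj) mj.
Qed.

Lemma unanimous_agree m i s : unanimous m s -> agree m i s.
Proof. by move=> H j _. Qed.
Arguments unanimous_agree [m] i [s] _ _ _.

Lemma routcome_unanimous m s : unanimous m s -> routcome m = yref s.
Proof.
move=> ms; rewrite /routcome; case: pselect => [e|[]]; last by exists s.
case: cid => s' /= ms'; congr yref.
have [i] : exists i : 'I_n, True by exists (Ordinal (ltn_trans (isT : 0 < 2)%N n3)).
by move=> _; apply: (agree_uniq (unanimous_agree i ms') (unanimous_agree i ms)).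
Qed.

Lemma routcome_deviate m i s : agree m i s -> ~ (exists s, unanimous m s) ->
  routcome m = deviate s (m i).
Proof.
move=> mi mu; rewrite /routcome; case: pselect => // _.
case: pselect => [e|[]]; last by exists (i, s).
case: cid => -[j s'] /= mj; have [ji|ij] := eqVneq j i.
  by case: _ / ji mj => /agree_uniq/(_ mi) ->.
by case: mu; exists s'; apply: agree_other mj mi ij.
Qed.

Lemma routcome_compete m : ~ (exists i s, agree m i s) -> routcome m = compete m.
Proof.
move=> mA; rewrite /routcome; case: pselect => [[s ms]|_].
  have i := Ordinal (ltn_trans (isT : 0 < 2)%N n3).
  by case: mA; exists i, s; exact: unanimous_agree.
by case: pselect => // -[[i s] /= ?]; case: mA; exists i, s.
Qed.

Lemma weight_gt0 k : 0 < weight k.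
Proof. by rewrite invr_gt0. Qed.

Lemma weight_itv k : 0 <= weight k <= 1.
Proof. by rewrite ltW ?weight_gt0//= invf_le1 ?ler1n. Qed.

Lemma is_mixed_ymix i s : is_mixed (dfwith (lam s) (w i) : mixed_profile M).
Proof. exact: dfwith_cdist (wm i) (lamm s). Qed.

Lemma lottery_ymix i s : lottery (ymix i s).
Proof. exact/lottery_induced/is_mixed_ymix. Qed.

Lemma lottery_yalt i (d : msg M i) s : lottery (yalt d s).
Proof. exact/lottery_induced/is_mixed_dirac. Qed.

Lemma lottery_routcome m : lottery (routcome m).
Proof.
rewrite /routcome; case: pselect => [e|_]; first exact: lottery_induced.
case: pselect => [e|_].
  rewrite /deviate; case: (m _) => [_|[[k plan] _]]; first exact: lottery_ymix.
  apply: lottery_mix; [exact: weight_itv|exact: lottery_ymix|exact: lottery_yalt].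
have lw := lottery_induced wm; rewrite /compete; case: pickP => // i _.
case: (m i) => [//|[[k _] x]].
by apply: lottery_mix; [exact: weight_itv| |exact: outcome_lottery].
Qed.

Definition rmech : mechanism R n Z := Mechanism lottery_routcome.

(** * Incentives in a fixed state *)

Section State.
Variable th : Theta.
Local Notation U i := (Uexp u i th).

(** These two suprema are what [i] can approach against an agreement on [s] and by winning the
    competition. They need not be attained, as message sets may be infinite. *)
Definition alt_sup i s := fsup (fun d => U i (yalt (i:=i) d s)).
Definition all_sup i := fsup (fun x : profile M => U i (outcome x)).

Lemma U_le i p : lottery p -> U i p <= Ubound u i th.
Proof. by move=> /(Uexp_bounded u i th); rewrite ler_norml => /andP[]. Qed.

Lemma le_alt_sup i (d : msg M i) s : U i (yalt d s) <= alt_sup i s.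
Proof.
by apply: (le_fsup (f := fun d => U i (yalt d s))) => c; exact/U_le/lottery_yalt.
Qed.

Lemma le_all_sup i (x : profile M) : U i (outcome x) <= all_sup i.
Proof.
apply: (le_fsup (f := fun x : profile M => U i (outcome x))) => c.
exact/U_le/outcome_lottery.
Qed.

Lemma induced_le_all_sup i (l : mixed_profile M) :
  is_mixed l -> U i (induced l) <= all_sup i.
Proof.
move=> lm; apply: (mean_le_cst (cdist_prodd lm) (mean_Uexp u i th lm)) => x.
exact: le_all_sup.
Qed.

Lemma mean_ymix i j s :
  mean (w i) (fun d => U j (yalt d s)) (U j (ymix i s)).
Proof.
have := mean_Uexp_dev u i j th (is_mixed_ymix i s); rewrite dfwith_in.
suff -> : (fun d : msg M i => U j (yalt d s)) =
  (fun d : msg M i => U j (ind (dfwith (dfwith (lam s) (w i)) (dirac d)))) by [].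
by apply/funext => d; rewrite dfwith_dfwith.
Qed.

Lemma ymix_le_alt_sup i s : U i (ymix i s) <= alt_sup i s.
Proof. by apply: (mean_le_cst (wm i) (mean_ymix i i s)) => d; exact: le_alt_sup. Qed.

Lemma yref_le_alt_sup i s : U i (yref s) <= alt_sup i s.
Proof.
apply: (mean_le_cst (lamm s i) (mean_Uexp_dev u i i th (lamm s))) => d.
exact: le_alt_sup.
Qed.

Lemma mix_le i e p q B : 0 <= e <= 1 -> U i p <= B -> U i q <= B ->
  U i (mix e p q) <= B.
Proof. by move=> /andP[? ?] ? ?; rewrite Uexp_mix; nra. Qed.

Lemma mix_eq i e p q B : 0 < e -> e <= 1 -> U i p <= B -> U i q <= B ->
  U i (mix e p q) = B -> U i p = B.
Proof. by move=> ? ? ? ?; rewrite Uexp_mix => ?; nra. Qed.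

Lemma deviate_le i s (t : rmsg i) : U i (deviate s t) <= alt_sup i s.
Proof.
case: t => [_|[[k plan] _]] /=; first exact: ymix_le_alt_sup.
by apply: mix_le; [exact: weight_itv|exact: ymix_le_alt_sup|exact: le_alt_sup].
Qed.

Lemma deviate_le_all i j s (t : rmsg i) : U j (deviate s t) <= all_sup j.
Proof.
have ym := induced_le_all_sup j (is_mixed_ymix i s).
case: t => [_|[[k plan] _]] //=; apply: mix_le => //; first exact: weight_itv.
exact/induced_le_all_sup/is_mixed_dirac.
Qed.

Lemma compete_le j m : U j (compete m) <= all_sup j.
Proof.
have lw := induced_le_all_sup j wm; rewrite /compete; case: pickP => // i _.
case: (m i) => [//|[[k _] x]].
by apply: mix_le; [exact: weight_itv| |exact: le_all_sup].
Qed.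

(** Depends only on the messages of the players other than [i]: an agreement among them on [s]
    confines [i] to deviations from [lam s], anything else lets [i] compete for any profile of
    [M]. *)
Definition best i m : R :=
  if pselect (exists s, agree m i s) is left e then alt_sup i (projT1 (cid e))
  else all_sup i.

Lemma best_agree i m s : agree m i s -> best i m = alt_sup i s.
Proof.
move=> mi; rewrite /best; case: pselect => [e|[]]; last by exists s.
by case: cid => s' /= /(agree_uniq mi) ->.
Qed.

Lemma best_all i m : ~ (exists s, agree m i s) -> best i m = all_sup i.
Proof. by rewrite /best; case: pselect. Qed.

(** At a proper deviation by [i], the last clause says that every other player faces no agreement,
    so that [all_sup] is the relevant bound. *)
Variant rcase m : Prop :=
  | Unanimous s of unanimous m s & routcome m = yref s
  | Deviation i s of agree m i s & ~ (exists s, unanimous m s) &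
      routcome m = deviate s (m i) &
      (forall j, j != i -> ~ exists s, agree m j s)
  | Competition of ~ (exists i s, agree m i s) & routcome m = compete m.

Lemma rcaseP m : rcase m.
Proof.
have [[s ms]|mu] := pselect (exists s, unanimous m s).
  exact: Unanimous ms (routcome_unanimous ms).
have [[i [s mi]]|mA] := pselect (exists i s, agree m i s); last first.
  exact: Competition mA (routcome_compete mA).
apply: (Deviation mi mu (routcome_deviate mi mu)) => j ji [s' mj].
by apply: mu; exists s'; exact: agree_other mj mi ji.
Qed.

Lemma routcome_le_best i m : U i (routcome m) <= best i m.
Proof.
case: (rcaseP m) => [s ms ->|j s mj _ -> mN|mA ->].
- by rewrite (best_agree (unanimous_agree i ms)) yref_le_alt_sup.
- have [ij|ij] := eqVneq i j; last by rewrite best_all ?deviate_le_all//; exact: mN.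
  by rewrite ij (best_agree mj); exact: deviate_le.
- rewrite best_all ?compete_le// => -[s mi]; apply: mA; by exists i, s.
Qed.

Lemma agree_upd m i (t : rmsg i) s : agree m i s -> agree (upd m t) i s.
Proof. by move=> mi j ji; rewrite upd_out// mi. Qed.

Lemma upd_agree m i (k : nat) plan x j s :
  agree (upd m (inr (k, plan, x) : rmsg i)) j s -> j = i /\ agree m i s.
Proof.
move=> H; have ji : j = i.
  apply/eqP; apply: contraT; rewrite eq_sym => /H; by rewrite upd_in.
split=> // k' ki; have := H k'; rewrite ji => /(_ ki); by rewrite upd_out.
Qed.

(** One message serves the whole finite set [A]: a bid above every bid in it and high enough to make
    the full-support term negligible, with a near-optimal plan for every reference reported in
    it. *)
Lemma best_approached i (A : seq rprofile) eps : 0 < eps ->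
  exists t : rmsg i, forall m, m \in A -> best i m - eps <= U i (routcome (upd m t)).
Proof.
move=> e0; have e20 : 0 < eps / 2 by rewrite divr_gt0.
pose B := Ubound u i th.
have [x Ux] : exists x : profile M, all_sup i - eps / 2 <= U i (outcome x).
  by apply: (fsup_adherent (B := B)) => // x; exact/U_le/outcome_lottery.
have altd s : exists d : msg M i, alt_sup i s - eps / 2 <= U i (yalt d s).
  by apply: (fsup_adherent (B := B)) => //; [exact: x0|move=> d; exact/U_le/lottery_yalt].
have B0 : 0 <= B by apply: sumr_ge0.
(* Two payoffs differ by at most [2 * B], so the full-support term costs at most half of [eps]; the
   other half covers the near-optimality of the plan and of [x]. *)
have [K KB] : exists K : nat, forall k, (K <= k)%N -> weight k * (2 * B) <= eps / 2.
  exists (Num.truncn (4 * B / eps)) => k Kk.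
  have : 4 * B / eps < k.+1%:R.
    by apply: lt_le_trans (truncnS_gt _) _; rewrite ler_nat ltnS.
  by rewrite ltr_pdivrMr// => H; rewrite /weight [leLHS]mulrC ler_pdivrMr//; nra.
pose size_of (j : 'I_n) (t : rmsg j) : nat :=
  match t with inl s => choice.pickle s | inr (k, _, _) => k.+1 end.
pose N := (K + (\sum_(m <- A) \sum_j size_of j (m j)).+1)%N.
have sizeN m j : m \in A -> (size_of j (m j) < N)%N.
  move=> mA; rewrite /N addnS ltnS (leq_trans _ (leq_addl _ _))//.
  rewrite (big_rem m)//= (bigD1 j)//= -addnA; exact: leq_addr.
pose plan := mkseq (fun k =>
  if choice.unpickle k is Some s then projT1 (cid (altd s)) else x0 i) N.
exists (inr (N, plan, x)) => m mA.
have mixU p q b : lottery p -> lottery q -> b - eps / 2 <= U i q ->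
    b - eps <= U i (mix (weight N) p q).
  move=> /(Uexp_bounded u i th) + /(Uexp_bounded u i th); rewrite -/B.
  rewrite !ler_norml => /andP[pB _] /andP[_ qB] bq; rewrite Uexp_mix.
  have WB := KB N (leq_addr _ _); have W0 := weight_gt0 N.
  have : 0 <= weight N * (2 * B - (U i q - U i p)) by apply: mulr_ge0; [exact: ltW|lra].
  by rewrite mulrBr; lra.
have [[s mi]|mN] := pselect (exists s, agree m i s).
  rewrite (best_agree mi) (@routcome_deviate _ i s).
  - rewrite upd_in /deviate nth_mkseq; last first.
      (* Some player other than [i] reports [s], so the index of [s] lies within the plan. *)
      have [j [ji _]] := third i i.
      by have := sizeN m j mA; rewrite (mi j ji).
    rewrite choice.pickleK; apply: mixU; [exact: lottery_ymix|exact: lottery_yalt|].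
    by case: cid.
  - exact: agree_upd.
  - by move=> [s' /(_ i)]; rewrite upd_in.
rewrite best_all// routcome_compete; last first.
  by move=> [j [s /upd_agree[_ ?]]]; apply: mN; exists s.
rewrite /compete; case: pickP => [j /forallP H|/(_ i)]; last first.
  move=> /negbT/forallPn[j]; rewrite negb_imply => /andP[ji].
  rewrite upd_in upd_out//= -leqNgt => H.
  have := sizeN m j mA; case: (m j) H => [//|[[k ?] ?]] /= H.
  by rewrite ltnNge (ltnW H).
have [ji|ji] := eqVneq j i.
  rewrite ji upd_in; apply: mixU => //; [exact: lottery_induced|exact: outcome_lottery].
have := H i; rewrite eq_sym ji upd_in upd_out//= => {}H.
have := sizeN m j mA; case: (m j) H => [//|[[k ?] ?]] /= H.
by move=> /(ltn_trans H); rewrite ltnNge leqnSn.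
Qed.

(** [mean_attained] with the bound [best]: in equilibrium, deviating to the message of
    [best_approached] does not pay, and by [mean_upd] its payoff is a mean over the same
    [prodd l]. *)
Lemma rmech_MNE_best (l : mixed_profile rmech) i m :
  MNE u th l -> 0 < prodd l m -> U i (routcome m) = best i m.
Proof.
move=> [lm Hl]; have ld := cdist_prodd lm; move: m.
apply: (mean_attained ld (mean_Uexp u i th lm) (C := Ubound u i th)).
- by move=> m; exact/Uexp_bounded/lottery_routcome.
- exact: routcome_le_best.
move=> A eps e0; have [t At] := best_approached i A e0.
have lt := is_mixed_dirac (M := rmech) (t : msg rmech i) lm.
exists (fun m => U i (routcome (upd m t))).
exists (U i (induced (dfwith l (dirac t) : mixed_profile rmech))).
split=> //.
- exact: (mean_upd lm (mean_Uexp u i th lt)).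
- by move=> m; exact/Uexp_bounded/lottery_routcome.
- by apply: Hl => // j ji; rewrite dfwith_out// eq_sym.
Qed.

(** Reaching the bound forces the full-support component [ymix i s] to reach it, and full support
    carries this over to every message of [i]. *)
Lemma deviate_indifferent i j s (t : rmsg i) B :
  (forall d : msg M i, U j (yalt d s) <= B) -> U j (deviate s t) = B ->
  forall d : msg M i, U j (yalt d s) = B.
Proof.
move=> yB; have yb := mean_le_cst (wm i) (mean_ymix i j s) yB.
suff H : U j (deviate s t) = B -> U j (ymix i s) = B.
  by move=> /H By d; apply: (mean_ge_cst (wm i) (mean_ymix i j s)) => //; rewrite By.
case: t => [_//|[[k plan] _]] /=; apply: mix_eq => //; first exact: weight_gt0.
by case/andP: (weight_itv k).
Qed.

Lemma deviate_support i s (t : rmsg i) z : 0 < deviate s t z ->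
  exists d : msg M i, 0 < yalt d s z.
Proof.
have yS : 0 < ymix i s z -> exists d : msg M i, 0 < yalt d s z.
  have := mean_induced_dev z i (is_mixed_ymix i s); rewrite dfwith_in => my y0.
  have [|//|d [_ d0]] := mean_gt0 (wm i) my.
    by move=> d; case: (lottery_induced (is_mixed_dirac d (is_mixed_ymix i s))).
  by exists d; rewrite dfwith_dfwith in d0.
case: t => [_|[[k plan] _]] /=; first exact: yS.
rewrite /mix; set d := nth _ _ _ => H.
have [/yS//|y0] := ltP 0 (ymix i s z); exists d.
by have := weight_gt0 k; have /andP[_] := weight_itv k; nra.
Qed.

(** As for deviations, with [prodd w] positive at every profile of [M]. *)
Lemma compete_indifferent j m : U j (compete m) = all_sup j ->
  forall x : profile M, U j (outcome x) = all_sup j.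
Proof.
move=> mE; suff By : U j (ind w) = all_sup j.
  move=> x; apply: (mean_ge_cst (cdist_prodd wm) (mean_Uexp u j th wm)).
  - by move=> y; exact: le_all_sup.
  - by rewrite By.
  - by apply: prodr_gt0.
move: mE; rewrite /compete; case: pickP => // i _; case: (m i) => [//|[[k _] x]].
apply: mix_eq; first exact: weight_gt0.
- by case/andP: (weight_itv k).
- exact: induced_le_all_sup.
- exact: le_all_sup.
Qed.

Lemma compete_support m z : 0 < compete m z -> exists x : profile M, 0 < outcome x z.
Proof.
have wS : 0 < ind w z -> exists x : profile M, 0 < outcome x z.
  move=> /(mean_gt0 (cdist_prodd wm) (mean_induced z wm))[|x [_ xz]].
    by move=> x; case: (outcome_lottery x).
  by exists x.
rewrite /compete; case: pickP => // i _; case: (m i) => [//|[[k _] x]].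
rewrite /mix => H; have [/wS//|w0z] := ltP 0 (ind w z); exists x.
by have := weight_gt0 k; have /andP[_] := weight_itv k; nra.
Qed.

(* [K] is the class of profiles whose equilibria define the outcomes of [M]:
   the pure ones, or all of them. *)
Variables (K : mixed_profile M -> Prop) (G : set Z).
Hypotheses (Kpure : forall x, K (pure x)) (Klam : forall s, K (lam s)).
Hypothesis Kdev : forall l i (d : msg M i), K l -> K (dfwith l (dirac d)).
Hypothesis KG : forall (l : mixed_profile M) z,
  K l -> MNE u th l -> 0 < induced l z -> G z.

Lemma best_outcome m z : (forall i, U i (routcome m) = best i m) ->
  0 < routcome m z -> G z.
Proof.
case: (rcaseP m) => [s ms ->|i s mi _ -> mN|mA ->] mE.
- apply: KG => //; apply/MNE_dirac_dev => // i d.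
  by rewrite [leRHS]mE (best_agree (unanimous_agree i ms)) le_alt_sup.
(* Against [lam s], player [i] is indifferent among all messages, and at each of them every other
   player gets the top payoff [all_sup]. Hence [lam s] with any message [d] for [i] is an
   equilibrium of [M]. *)
- have iE : forall d : msg M i, U i (yalt d s) = alt_sup i s.
    apply: (@deviate_indifferent i i s (m i)); last by rewrite mE (best_agree mi).
    by move=> d; exact: le_alt_sup.
  have jE j : j != i -> forall d : msg M i, U j (yalt d s) = all_sup j.
    move=> ji; apply: (@deviate_indifferent i j s (m i)); last first.
      by rewrite mE best_all//; exact: mN.
    by move=> d; exact/induced_le_all_sup/is_mixed_dirac.
  move=> /deviate_support[d]; apply: KG; first exact: Kdev.
  have dm := is_mixed_dirac d (lamm s); apply/MNE_dirac_dev => // j c.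
  have [ji|ji] := eqVneq j i; last first.
    by rewrite [leRHS](jE j ji d); exact/induced_le_all_sup/is_mixed_dirac.
  by move: c; rewrite ji => c; rewrite dfwith_dfwith [leLHS]iE [leRHS]iE.
(* Every player is indifferent among all profiles of [M], so each of these is a pure equilibrium. *)
- have jE j :=
    compete_indifferent (etrans (mE j) (best_all (fun e => mA (ex_intro _ j e)))).
  move=> /compete_support[x xz]; apply: (KG (Kpure x)); last by rewrite induced_pure.
  apply/PNE_MNE => j x' _; by rewrite !jE.
Qed.

Lemma rmech_mixed_sub : mixed_eq_outcomes u rmech th `<=` G.
Proof.
move=> z [l [le]]; have lm := le.1.
move=> /(mean_gt0 (cdist_prodd lm) (mean_induced z lm))[|m [lm0]].
  by move=> m; case: (lottery_routcome m).
by apply: best_outcome => i; exact: rmech_MNE_best le lm0.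
Qed.

(** All players report [s]. Whoever departs obtains at most [alt_sup], which cannot exceed the
    payoff of [lam s], an equilibrium of [M]. *)
Lemma rmech_pure_ref s z : MNE u th (lam s) -> 0 < yref s z ->
  pure_eq_outcomes u rmech th z.
Proof.
move=> se sz; pose m : rprofile := [ffun i => inl s].
have ms : unanimous m s by move=> i; rewrite ffunE.
exists m; rewrite /= (routcome_unanimous ms); split=> // i m' m'm.
have m's : agree m' i s by move=> j ji; rewrite m'm// ms.
apply: le_trans (routcome_le_best i m') _; rewrite (best_agree m's).
rewrite /= (routcome_unanimous ms); apply: fsup_le => [|d]; first exact: x0.
by move/MNE_dirac_dev : se; exact.
Qed.

End State.
End Construction.

(** Geometric weights along [pickle], normalised: their total is at most [1] because the codes are
    distinct, and positive because of [t0]. *)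
Lemma cdist_full_support (R : realType) (T : countType) (t0 : T) :
  exists w : T -> R, cdist w /\ forall t, 0 < w t.
Proof.
pose q (k : nat) : R := 1 / (2 ^ k.+1)%:R.
have q0 k : 0 < q k by rewrite divr_gt0// ltr0n expn_gt0.
pose v := (\esum_(t in [set: T]) (q (choice.pickle t))%:E)%E.
have v1 : (v <= 1)%E.
  apply: (@le_trans _ _ (\esum_(k in [set: nat]) (q k)%:E)%E); last first.
    rewrite -nneseries_esumT; first exact: epsilon_trick0.
    by move=> k; rewrite lee_fin ltW.
  have -> : v = (\esum_(k in [set choice.pickle t | t in [set: T]]) (q k)%:E)%E.
    by rewrite esum_image// => s t _ _ /(pcan_inj choice.pickleK).
  rewrite esum_mkcond; apply: le_esum => k _.
  by case: ifP => // _; rewrite lee_fin ltW.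
have v0 : ((q (choice.pickle t0))%:E <= v)%E.
  have <- : (\esum_(t in [set t0]) (q (choice.pickle t))%:E =
      (q (choice.pickle t0))%:E)%E by rewrite esum_set1// lee_fin ltW.
  rewrite esum_mkcond; apply: le_esum => t _.
  by case: ifP => // _; rewrite lee_fin ltW.
have [r vr] : exists r : R, v = r%:E.
  by move: v v1 v0 => [r _ _||]; [exists r|rewrite leye_eq|rewrite leeNy_eq].
have r0 : 0 < r by move: v0; rewrite vr lee_fin; apply: lt_le_trans.
exists (fun t => r^-1 * q (choice.pickle t)); split=> [|t]; last first.
  by rewrite mulr_gt0 ?invr_gt0.
split=> [t|]; first by rewrite mulr_ge0 ?invr_ge0 ?ltW.
under eq_esum do rewrite EFinM.
rewrite esumZl ?invr_ge0 ?ltW// => [|t]; last by rewrite lee_fin ltW.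
by rewrite -/v vr -EFinM mulVf// gt_eqF.
Qed.

(** * From a class of reference equilibria to the equivalence *)

Section Implementation.
Context {R : realType} {n : nat} {Theta : countType} {Z : finType}.
Variables (u : 'I_n -> Theta -> Z -> R) (F : Theta -> {set Z}).
Hypotheses (n3 : (3 <= n)%N) (F0 : SCC F).

(** In the new mechanism mixed outcomes lie in [F], each outcome in [F] arises from the pure
    unanimous report of its reference, and pure outcomes are mixed ones; this cycle makes the three
    sets equal. *)
Lemma implementable_B (M : mechanism R n Z) (K : mixed_profile M -> Prop) :
  (forall x, K (pure x)) ->
  (forall l i (d : msg M i), K l -> K (dfwith l (dirac d))) ->
  (forall th z, z \in F th <->
     exists l : mixed_profile M, [/\ K l, MNE u th l & 0 < induced l z]) ->
  mixed_Nash_B_implementable u F.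
Proof.
move=> Kpure Kdev KF.
(* Without states every mechanism implements [F]. With a state, nonemptiness of [F] yields an
   equilibrium of [M], hence a message for each player. *)
have [[th0 _]|T0] := pselect (exists th : Theta, True); last first.
  by exists M => th; case: T0; exists th.
have [z0 z0F] : exists z, z \in F th0 by apply/set0Pn/F0.
have [l0 [_ [l0m _] _]] := (KF th0 z0).1 z0F.
have inh i : exists x : msg M i, True := cdist_inhabited (l0m i).
pose x0 : profile M := finfun (fun i => projT1 (cid (inh i))).
have ws i := cid (@cdist_full_support R _ (x0 i)).
pose w : mixed_profile M := fun i => projT1 (ws i).
have wm : is_mixed w by move=> i; rewrite /w; case: (ws i) => ? [].
have w0 i (d : msg M i) : 0 < w i d by rewrite /w; case: (ws i) => ? [].
(* The references are the pairs of a state and an outcome chosen there, countable because [Theta] is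
   countable and [Z] finite. *)
pose S : countType := {p : Theta * Z | p.2 \in F p.1}.
have lS (s : S) := cid ((KF (val s).1 (val s).2).1 (valP s)).
pose lam (s : S) := projT1 (lS s).
have lamP s : [/\ K (lam s), MNE u (val s).1 (lam s) & 0 < induced (lam s) (val s).2].
  by rewrite /lam; case: (lS s).
have lamm s : is_mixed (lam s) by case: (lamP s) => _ [].
exists (rmech x0 wm lamm) => th; set M' := rmech _ _ _.
have mF : mixed_eq_outcomes u M' th `<=` [set z | z \in F th].
  apply: (rmech_mixed_sub n3 w0 (K := K)) => //.
  - by move=> s; case: (lamP s).
  - by move=> l z Kl le lz; apply/KF; exists l.
have Fp : [set z | z \in F th] `<=` pure_eq_outcomes u M' th.
  move=> z /= zF; have [_ se sz] := lamP (exist _ (th, z) zF).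
  exact: (rmech_pure_ref n3 x0 wm lamm se sz).
have pm := @pure_sub_mixed _ _ _ _ u M' th.
by split; apply/seteqP; split=> // z; [move/mF/Fp | move/pm/mF].
Qed.

Lemma pure_implementable_B :
  pure_Nash_implementable u F -> mixed_Nash_B_implementable u F.
Proof.
move=> [M MF]; apply: (@implementable_B M (fun l => exists x, l = pure x)).
- by move=> x; exists x.
- by move=> _ i d [x ->]; exists (upd x d); rewrite pure_upd.
move=> th z; have -> : (z \in F th) = [set z | z \in F th] z :> Prop by [].
rewrite -MF; split=> [[m [/PNE_MNE me mz]]|[_ [[m ->] me]]].
  by exists (pure m); split; [exists m| |rewrite induced_pure].
by rewrite induced_pure; exists m; split=> //; exact/PNE_MNE.
Qed.

Lemma mixed_implementable_B :
  mixed_Nash_A_implementable u F -> mixed_Nash_B_implementable u F.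
Proof.
move=> [M MF]; apply: (@implementable_B M (fun=> True)) => // th z.
have -> : (z \in F th) = [set z | z \in F th] z :> Prop by [].
by rewrite -MF; split=> [[l [le lz]]|[l [_ le lz]]]; exists l.
Qed.

End Implementation.

Theorem theorem3 (R : realType) (n : nat) (Theta : countType) (Z : finType)
    (u : 'I_n -> Theta -> Z -> R) (F : Theta -> {set Z}) :
  (3 <= n)%N -> SCC F ->
  (pure_Nash_implementable u F <-> mixed_Nash_A_implementable u F) /\
  (mixed_Nash_A_implementable u F <-> mixed_Nash_B_implementable u F).
Proof.
move=> n3 F0; have pB := pure_implementable_B n3 F0.
have AB := mixed_implementable_B n3 F0.
have BA : mixed_Nash_B_implementable u F -> mixed_Nash_A_implementable u F.
  by move=> [M MF]; exists M => th; case: (MF th) => ->.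
have Bp : mixed_Nash_B_implementable u F -> pure_Nash_implementable u F.
  by move=> [M MF]; exists M => th; case: (MF th).
by split; split=> H; [exact/BA/pB | exact/Bp/AB | exact: AB | exact: BA].
Qed.
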